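(* Let $n\ge1$ and let $T$ be the adjacency matrix of the Kneser graph $K(2n+1,n)$: its rows and columns are indexed by the $n$-element subsets of $\{1,\dots,2n+1\}$, with $(A,B)$ entry $1$ if $A\cap B=\emptyset$ and $0$ otherwise. Let $\mathcal T$ be the commutant of the natural permutation action of $\mathfrak S_{2n+1}$ on these subsets. Then \[\|T\|_m=\|S_T|_{\mathcal T}\|=\frac{2^{2n}}{\binom{2n+1}n}=\frac{4\cdot6\cdots(2n+2)}{3\cdot5\cdots(2n+1)}=\prod_{i=1}^n\Big(1+\frac1{2i+1}\Big)>\frac12\log(2n+3).\]
   Context: For a matrix $T=[t_{AB}]$, $S_T$ denotes the Schur multiplier $R=[r_{AB}]\mapsto[t_{AB}r_{AB}]$ on matrices indexed by the same set (with the operator norm), $\|T\|_m$ its norm, and $\|S_T|_{\mathcal T}\|$ the norm of its restriction to $\mathcal T$. The action is $\sigma\cdot e_A=e_{\sigma(A)}$ on the Hilbert space with orthonormal basis indexed by the $n$-element subsets. *)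

(* Defs.v *)
From HB Require Import structures.
From mathcomp Require Import all_boot all_order all_algebra all_fingroup.
From mathcomp Require Import complex.
From mathcomp Require Import all_classical all_reals.
From mathcomp Require Import exp.

Set Implicit Arguments.
Unset Strict Implicit.
Unset Printing Implicit Defensive.
Import Order.TTheory GRing.Theory Num.Theory.
Local Open Scope ring_scope.
Local Open Scope classical_set_scope.

Definition nsub (n : nat) : finType :=
  {A : {set 'I_(n.*2.+1)} | #|A| == n}.

Section Defs.
Variable R : realType.
Variable n : nat.

Local Notation C := R[i].
Local Notation I := (nsub n).

Definition mat := I -> I -> C.
Definition vect := I -> C.

Definition cabs2 (z : C) : R := (complex.Re z) ^+ 2 + (complex.Im z) ^+ 2.

Definition vnorm (x : vect) : R := Num.sqrt (\sum_(A : I) cabs2 (x A)).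

Definition mapply (M : mat) (x : vect) : vect := fun A => \sum_(B : I) M A B * x B.

Definition mmul (M N : mat) : mat := fun A B => \sum_(D : I) M A D * N D B.

Definition opnorm (M : mat) : R :=
  sup [set r : R | exists x : vect, vnorm x <= 1 /\ r = vnorm (mapply M x)].

Definition schur (T M : mat) : mat := fun A B => T A B * M A B.

Definition schur_norm (T : mat) : R :=
  sup [set r : R | exists M : mat, opnorm M <= 1 /\ r = opnorm (schur T M)].

(* The unitary U_sigma with U_sigma e_B = e_{sigma(B)}; matrix entry (A,B). *)
Definition perm_op (s : {perm 'I_(n.*2.+1)}) : mat :=
  fun A B => if val A == s @: val B then 1 else 0.

Definition in_commutant (M : mat) : Prop :=
  forall s : {perm 'I_(n.*2.+1)}, mmul M (perm_op s) = mmul (perm_op s) M.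

Definition schur_norm_commutant (T : mat) : R :=
  sup [set r : R | exists M : mat,
        in_commutant M /\ opnorm M <= 1 /\ r = opnorm (schur T M)].

Definition kneser : mat :=
  fun A B => if [disjoint val A & val B] then 1 else 0.

End Defs.

(* Main.v *)
Require Import Defs.
From HB Require Import structures.
From mathcomp Require Import all_boot all_order all_algebra all_fingroup.
From mathcomp Require Import complex.
From mathcomp Require Import all_classical all_reals.
From mathcomp Require Import exp sequences ring lra zify.
(* Shadows the homonymous lemmas of [classical_sets]. *)
From mathcomp Require Import fintype finset.
Import Order.TTheory GRing.Theory Num.Theory.
Set Implicit Arguments.
Unset Strict Implicit.
Unset Printing Implicit Defensive.
Local Open Scope ring_scope.

(* For [i <= n] let [W_i] be the inclusion matrix of [i]-subsets against
   [n]-subsets and [F_i] the orthogonal projection onto its row space.  The row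
   spaces increase with [i] and exhaust everything at [i = n], and [W_i] has full
   rank, so [\tr F_i = 'C(2n+1, i)].  Since [W_i T] is [n+1-i] times the
   disjointness matrix, which by inclusion-exclusion is [(-1)^i W_i] modulo
   lower levels, [T] acts on the range of [E_i := F_i - F_(i-1)] as the scalar
   [(-1)^i (n+1-i)].  Hence [|T| = \sum_i (n+1-i) E_i = \sum_i F_i] has trace
   [2^(2n)] and, being invariant under a transitive action, constant diagonal
   [v = 2^(2n) / 'C(2n+1, n)].

   Upper bound: [T A B = \sum_(i, D) (-1)^i (n+1-i) E_i A D * E_i D B] is a
   factorization through vectors of square norm [v].  Lower bound: the unitary
   [U = \sum_i (-1)^i E_i], the sign of [T], lies in the commutant and the Schur
   product of [T] and [U] maps the all-ones vector to [v] times itself. *)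

(** * Counting and permuting subsets of a finite set *)

Section FiniteSets.
Variable T : finType.
Implicit Types A B X Y : {set T}.

(** Removing [X] from [B] gives a bijection onto the subsets of size [k - #|X|] of the complement of
    [X :|: Y]. If [X] meets [Y], no such [B] exists. *)
Lemma card_extensions X Y k : (#|X| <= k)%N ->
  #|[set B : {set T} | (#|B| == k) && ((X \subset B) && [disjoint B & Y])]| =
  ([disjoint X & Y] * 'C(#|T| - #|X| - #|Y|, k - #|X|))%N.
Proof.
move=> leXk; have [dXY|ndXY] := boolP [disjoint X & Y]; last first.
  rewrite mul0n; apply: eq_card0 => B; rewrite !inE.
  apply/negP => /and3P[_ sXB dBY]; case/negP: ndXY.
  exact: disjointWl sXB dBY.
rewrite mul1n.
have -> : (#|T| - #|X| - #|Y| = #|~: (X :|: Y)|)%N.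
  by rewrite [RHS]cardsCs setCK cardsU (disjoint_setI0 dXY) cards0 subn0 subnDA.
rewrite -cards_draws -[RHS](card_in_imset (f := fun D => X :|: D)); last first.
  have dis D : D \in [set A : {set T} | A \subset ~: (X :|: Y) & #|A| == (k - #|X|)%N] ->
      (X :|: D) :\: X = D.
    rewrite inE => /andP[/subsetP sD _]; apply/setP => x; rewrite !inE.
    case xD: (x \in D); rewrite ?orbF ?orbT ?andbT ?andNb //.
    by move: (sD x xD); rewrite !inE negb_or => /andP[].
  by move=> D1 D2 h1 h2 e; rewrite -(dis _ h1) -(dis _ h2) e.
apply: eq_card => B; rewrite inE; apply/idP/imsetP.
  case/and3P=> /eqP cB sXB dBY; exists (B :\: X); last first.
    apply/setP => x; rewrite !inE; have := subsetP sXB x.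
    by case: (x \in X) => //= ->.
  rewrite inE cardsD (setIidPr sXB) cB eqxx andbT.
  apply/subsetP => x; rewrite !inE negb_or => /andP[-> xB] /=.
  by rewrite (disjointFr dBY xB).
case=> D; rewrite inE => /andP[sD /eqP cD] ->.
have dDX : [disjoint X & D].
  rewrite disjoint_sym disjoints_subset; apply: subset_trans sD _.
  by rewrite setCS subsetUl.
rewrite cardsU (disjoint_setI0 dDX) cards0 subn0 cD subnKC // eqxx subsetUl /=.
rewrite disjoints_subset subUset -!disjoints_subset dXY disjoints_subset.
by apply: subset_trans sD _; rewrite setCS subsetUr.
Qed.

(** Expand the product over all [x] of [1 - (x \in X)%:R]: the terms are indexed by subsets [S] and
    vanish unless [S \subset X]. *)
Lemma sum_sign_subsets (R : comNzRingType) X :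
  \sum_(S : {set T} | S \subset X) (-1) ^+ #|S| = (X == set0)%:R :> R.
Proof.
have := @bigA_distr R 0 1 *%R +%R T
  (fun x : T => - (x \in X)%:R) (fun _ => 1).
rewrite (_ : \big[_/_]_i _ = (X == set0)%:R); last first.
  have [->|/set0Pn[x xX]] := eqVneq X set0.
    by rewrite big1 // => i _; rewrite inE oppr0; exact: add0r.
  by rewrite (bigD1 x) //= xX [X in X * _]addNr mul0r.
move=> ->; rewrite big_mkcond /=; apply: eq_bigr => S _.
have [sSX|/subsetPn[x xS xX]] := boolP (S \subset X); last first.
  by rewrite (bigD1 x) //= xS (negPf xX) oppr0 mul0r.
rewrite -big_mkcond /= -prodr_const; apply: eq_bigr => i iS.
by rewrite (subsetP sSX).
Qed.

(** Induction on [#|A :\: B|]: a transposition swapping a point of [A :\: B] with a point of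
    [B :\: A] makes the difference smaller. *)
Lemma perm_imset_transitive A B :
  #|A| = #|B| -> exists s : {perm T}, s @: A = B.
Proof.
have [k] := ubnP #|A :\: B|; elim: k A => // k IHk A ltk eqAB.
have [sAB|] := boolP (A \subset B).
  exists 1%g; rewrite (eq_imset (g := id)) ?imset_id; last exact: perm1.
  by apply/eqP; rewrite eqEcard sAB eqAB /=.
case/subsetPn=> x xA xB.
have : ~~ (B \subset A).
  apply/negP => sBA; case/negP: xB; suff -> : B = A by [].
  by apply/eqP; rewrite eqEcard sBA eqAB leqnn.
case/subsetPn=> y yB yA.
pose t := tperm x y.
have [||s sB] := IHk (t @: A); last 1 first.
- exists (t * s)%g; rewrite -sB -imset_comp; apply: eq_imset => z /=.
  by rewrite permM.
- suff /proper_card ltA : (t @: A) :\: B \proper A :\: B.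
    by apply: leq_trans ltA _.
  apply/properP; split; last first.
    exists x; first by rewrite !inE xA xB.
    rewrite inE xB /= -(tpermR x y) mem_imset ?(negPf yA) //.
    exact: perm_inj.
  apply/subsetP => z; rewrite !inE => /andP[zB /imsetP[w wA zE]].
  rewrite zB; move: zB; rewrite zE /t.
  by case: tpermP => // _; rewrite yB.
- by rewrite card_imset //; exact: perm_inj.
Qed.

Lemma imset_permK (s : {perm T}) A : s^-1%g @: (s @: A) = A.
Proof.
by rewrite -imset_comp -[RHS]imset_id; apply: eq_imset => x /=; rewrite permK.
Qed.

Lemma eq_imset_perm (s : {perm T}) A B : (A == s @: B) = (s^-1%g @: A == B).
Proof.
apply/eqP/eqP => [->|<-]; first exact: imset_permK.
by have := imset_permK s^-1%g A; rewrite invgK.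
Qed.

End FiniteSets.

(** * Inclusion and disjointness matrices between levels of the Boolean lattice *)

Section InclusionMatrices.
Variables (R : comNzRingType) (m : nat).

Definition ksub (k : nat) : finType := {A : {set 'I_m} | #|A| == k}.

Definition kset k (i : 'I_#|ksub k|) : {set 'I_m} := val (enum_val i : ksub k).

Definition incl_mx k l : 'M[R]_(#|ksub k|, #|ksub l|) :=
  \matrix_(i, j) (kset i \subset kset j)%:R.

Definition disj_mx k l : 'M[R]_(#|ksub k|, #|ksub l|) :=
  \matrix_(i, j) [disjoint kset i & kset j]%:R.

Lemma card_kset k (i : 'I_#|ksub k|) : #|kset i| = k.
Proof. exact/eqP/(valP (enum_val i : ksub k)). Qed.

Lemma card_ksub k : #|ksub k| = 'C(m, k).
Proof.
rewrite card_sig -[X in 'C(X, _)](card_ord m) -card_draws.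
by apply: eq_card => A; rewrite !inE.
Qed.

Lemma sum_ksub (V : nmodType) k (F : {set 'I_m} -> V) :
  \sum_(i < #|ksub k|) F (kset i) =
  \sum_(A : {set 'I_m} | #|A| == k) F A.
Proof.
rewrite (big_sub (fun A : {set 'I_m} => #|A| == k)).
by rewrite -(big_enum_val (fun A : ksub k => F (val A))).
Qed.

Lemma sum_ksub_extensions (X Y : {set 'I_m}) k : (#|X| <= k)%N ->
  \sum_(i < #|ksub k|) (X \subset kset i)%:R *
     [disjoint kset i & Y]%:R =
  'C(m - #|X| - #|Y|, k - #|X|)%:R * [disjoint X & Y]%:R :> R.
Proof.
move=> leXk; rewrite (sum_ksub k (fun B => (X \subset B)%:R * [disjoint B & Y]%:R)).
have := card_extensions Y leXk; rewrite card_ord => cardE.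
rewrite -natrM mulnC -cardE -sum1_card natr_sum big_mkcond [RHS]big_mkcond /=.
apply: eq_bigr => B _; rewrite inE.
by case: (#|B| == k); case: (X \subset B); case: [disjoint B & Y];
  rewrite /= ?(mulr0, mul0r, mulr1).
Qed.

Lemma mul_incl_disj i k l : (i <= k)%N ->
  incl_mx i k *m disj_mx k l = 'C(m - i - l, k - i)%:R *: disj_mx i l.
Proof.
move=> leik; apply/matrixP => a b; rewrite !mxE.
under eq_bigr do rewrite !mxE.
by rewrite sum_ksub_extensions ?card_kset.
Qed.

(** Inclusion in a set is disjointness from its complement, so the count behind [mul_incl_disj]
    applies again. *)
Lemma mul_incl_incl j i l : (j <= i)%N ->
  incl_mx j i *m incl_mx i l = 'C(l - j, i - j)%:R *: incl_mx j l.
Proof.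
move=> leji; apply/matrixP => a b; rewrite !mxE.
set B := kset b.
have disjC (X : {set 'I_m}) : [disjoint X & ~: B] = (X \subset B).
  by rewrite disjoints_subset setCK.
under eq_bigr do rewrite !mxE -disjC.
rewrite sum_ksub_extensions ?card_kset // disjC; congr ('C(_, _)%:R * _).
have := cardsC B; rewrite card_ord card_kset; lia.
Qed.

Lemma sum_sign_ksub (X : {set 'I_m}) i : (#|X| <= i)%N ->
  \sum_(j < i.+1) (-1) ^+ j *
    \sum_(k < #|ksub j|) (kset k \subset X)%:R = (X == set0)%:R :> R.
Proof.
move=> leXi; rewrite -sum_sign_subsets.
(* Group the subsets of [X] by size; [inord] does not distort these sizes because [#|X| <= i]. *)
rewrite [RHS](partition_big (fun S : {set 'I_m} => inord #|S| : 'I_i.+1) xpredT) //=.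
apply: eq_bigr => j _; rewrite (sum_ksub j (fun S => (S \subset X)%:R)).
rewrite mulr_sumr big_mkcond [RHS]big_mkcond; apply: eq_bigr => S _ /=.
have [sSX|_] := boolP (S \subset X); last by rewrite mulr0 if_same.
have ltS : (#|S| < i.+1)%N by rewrite ltnS (leq_trans (subset_leq_card sSX)).
rewrite -val_eqE /= inordK // mulr1.
by have [->|//] := eqVneq #|S| j.
Qed.

(** Inclusion-exclusion on the intersection: the [j]-th product counts the [j]-subsets common to the
    row set and the column set. *)
Lemma disj_mx_incl i l :
  disj_mx i l = \sum_(j < i.+1) (-1) ^+ j *: ((incl_mx j i)^T *m incl_mx j l).
Proof.
apply/matrixP => a b; rewrite summxE !mxE -setI_eq0.
rewrite -(@sum_sign_ksub _ i); last first.
  by rewrite (leq_trans (subset_leq_card (subsetIl _ _))) ?card_kset.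
apply: eq_bigr => j _; rewrite !mxE; congr (_ * _); apply: eq_bigr => k _.
by rewrite !mxE subsetI -natrM mulnb.
Qed.

(** The [j]-th product counts the [j]-subsets of [B :\: A], so the alternating sum detects
    [B \subset A], which is equality since both have size [i]. This supplies the right inverse in
    [row_free_incl]. *)
Lemma sum_disj_incl i :
  \sum_(j < i.+1) (-1) ^+ j *: (disj_mx i j *m incl_mx j i) = 1%:M.
Proof.
apply/matrixP => a b; rewrite summxE !mxE.
set A := kset a; set B := kset b.
transitivity ((B :\: A == set0)%:R : R).
  rewrite -(@sum_sign_ksub _ i); last first.
    by rewrite (leq_trans (subset_leq_card (subsetDl _ _))) ?card_kset.
  apply: eq_bigr => j _; rewrite !mxE; congr (_ * _); apply: eq_bigr => k _.
  by rewrite !mxE subsetD -natrM mulnb andbC disjoint_sym.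
congr (_%:R); congr nat_of_bool; rewrite setD_eq0.
apply/idP/eqP => [sBA|ab]; last by rewrite /A /B ab.
apply: enum_val_inj; apply: val_inj; apply/esym/eqP.
by rewrite eqEcard sBA !card_kset /=.
Qed.

End InclusionMatrices.

(** * Orthogonal projection onto a row space *)

Section OrthogonalProjection.
Variables (R : realFieldType) (r N : nat).
Implicit Types W : 'M[R]_(r, N).

(** Vectors are rows and matrices act on the right. The formula is the orthogonal projection once
    [W] has independent rows, which makes the Gram matrix invertible. *)
Definition oproj W : 'M[R]_N := W^T *m invmx (W *m W^T) *m W.

Lemma mulmx_tr_eq0 (x : 'rV[R]_N) : x *m x^T = 0 -> x = 0.
Proof.
move=> /matrixP /(_ 0 0); rewrite !mxE => /eqP.
rewrite psumr_eq0; last by move=> i _; rewrite mxE -expr2 sqr_ge0.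
move=> /allP x0; apply/rowP => i; rewrite mxE.
have := x0 i; rewrite mem_index_enum mxE => /(_ isT).
by rewrite /= mulf_eq0 orbb => /eqP.
Qed.

(** If [x] kills the Gram matrix, then [x *m W] has square norm zero, hence [x = 0]. *)
Lemma gram_unitmx W : row_free W -> W *m W^T \in unitmx.
Proof.
move=> freeW; rewrite -row_free_unit -kermx_eq0; apply/rowV0P => x.
move/sub_kermxP => xWW; have /mulmx_tr_eq0 xW : (x *m W) *m (x *m W)^T = 0.
  by rewrite trmx_mul mulmxA -[x *m W *m _]mulmxA xWW mul0mx.
by apply: (row_free_inj freeW); rewrite mul0mx.
Qed.

Lemma oproj_sub W : (oproj W <= W)%MS.
Proof. exact: submxMl. Qed.

Lemma tr_oproj W : (oproj W)^T = oproj W.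
Proof.
by rewrite /oproj !trmx_mul trmxK trmx_inv trmx_mul trmxK mulmxA.
Qed.

Lemma mul_oproj W k (X : 'M_(k, N)) :
  row_free W -> (X <= W)%MS -> X *m oproj W = X.
Proof.
move=> freeW /submxP[Y ->].
by rewrite /oproj !mulmxA -(mulmxA Y) mulmxK // gram_unitmx.
Qed.

Lemma mxtrace_oproj W : row_free W -> \tr (oproj W) = r%:R.
Proof.
by move=> freeW; rewrite mxtrace_mulC mulmxA mulmxV ?gram_unitmx // mxtrace1.
Qed.

(** With [P] the projection, invariance under [K] gives [P K P = P K], and invariance under [K^T]
    gives, after transposing, [P K P = K P]. *)
Lemma oproj_comm W (K : 'M_N) : row_free W ->
  (W *m K <= W)%MS -> (W *m K^T <= W)%MS -> oproj W *m K = K *m oproj W.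
Proof.
move=> freeW sWK sWKt.
have invariant L : (W *m L <= W)%MS -> oproj W *m L *m oproj W = oproj W *m L.
  move=> sWL; apply: mul_oproj => //; apply: submx_trans sWL.
  exact/submxMr/oproj_sub.
have /(congr1 trmx) := invariant _ sWKt.
rewrite (trmx_mul (oproj W *m _)) !(trmx_mul (oproj W)) trmxK tr_oproj mulmxA.
by move=> <-; exact/esym/invariant.
Qed.

End OrthogonalProjection.

(** * The symmetric group acting on subsets of fixed size *)

Section PermutationAction.
Variables (R : comNzRingType) (m : nat).
Implicit Types s : {perm 'I_m}.

Lemma kact_subproof k s (a : 'I_#|ksub m k|) : #|s @: kset a| == k.
Proof. by rewrite card_imset ?card_kset //; exact: perm_inj. Qed.

Definition kact k s (a : 'I_#|ksub m k|) : 'I_#|ksub m k| :=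
  enum_rank (Sub (s @: kset a) (kact_subproof s a) : ksub m k).

Lemma kset_inj k : injective (@kset m k).
Proof. by move=> a b /val_inj /enum_val_inj. Qed.

Lemma kset_act k s (a : 'I_#|ksub m k|) : kset (kact s a) = s @: kset a.
Proof. by rewrite /kset /kact enum_rankK. Qed.

Lemma kactK k s : cancel (@kact k s) (@kact k s^-1%g).
Proof.
by move=> a; apply: kset_inj; rewrite !kset_act imset_permK.
Qed.

Lemma kactKV k s : cancel (@kact k s^-1%g) (@kact k s).
Proof. by move=> a; have := @kactK k s^-1%g a; rewrite invgK. Qed.

Lemma eq_kact k s (a b : 'I_#|ksub m k|) : (a == kact s b) = (kact s^-1%g a == b).
Proof.
by apply/eqP/eqP => [->|<-]; rewrite ?kactK ?kactKV.
Qed.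

Lemma kact_transitive k (a b : 'I_#|ksub m k|) : exists s, kact s a = b.
Proof.
have [|s sab] := @perm_imset_transitive _ (kset a) (kset b).
  by rewrite !card_kset.
by exists s; apply: kset_inj; rewrite kset_act.
Qed.

Definition kperm_mx k s : 'M[R]_#|ksub m k| := \matrix_(a, b) (a == kact s b)%:R.

Lemma mulmx_kperm p k s (M : 'M_(p, #|ksub m k|)) a b :
  (M *m kperm_mx k s) a b = M a (kact s b).
Proof.
rewrite mxE (bigD1 (kact s b)) //= mxE eqxx mulr1 big1 ?addr0 // => c /negPf ne.
by rewrite mxE ne mulr0.
Qed.

Lemma mul_kperm_mx p k s (M : 'M_(#|ksub m k|, p)) a b :
  (kperm_mx k s *m M) a b = M (kact s^-1%g a) b.
Proof.
rewrite mxE (bigD1 (kact s^-1%g a)) //= mxE kactKV eqxx mul1r big1 ?addr0 //.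
by move=> c /negPf ne; rewrite mxE eq_kact eq_sym ne mul0r.
Qed.

Lemma tr_kperm_mx k s : (kperm_mx k s)^T = kperm_mx k s^-1%g.
Proof. by apply/matrixP => a b; rewrite !mxE eq_kact eq_sym. Qed.

Lemma incl_kperm k l s :
  incl_mx R m k l *m kperm_mx l s = kperm_mx k s *m incl_mx R m k l.
Proof.
apply/matrixP => a b; rewrite mulmx_kperm mul_kperm_mx !mxE.
congr (_%:R); congr nat_of_bool; rewrite -[in LHS](kactKV s a) !kset_act.
set A := s^-1%g @: _; apply/idP/idP => [/subsetP sAB|]; last exact: imsetS.
apply/subsetP => x xA; have := sAB _ (imset_f s xA).
by rewrite mem_imset //; exact: perm_inj.
Qed.

End PermutationAction.

(** * Spectral decomposition of the disjointness matrix *)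

Section OddGraphSpectrum.
Variables (R : realFieldType) (n : nat).
Local Notation m := n.*2.+1.
Local Notation N := #|ksub m n|.
Local Notation W i := (incl_mx R m i n).

Lemma incl_mx_id k : incl_mx R m k k = 1%:M.
Proof.
apply/matrixP => a b; rewrite !mxE; congr (_%:R); congr nat_of_bool.
apply/idP/eqP => [sab|->//]; apply: kset_inj; apply/eqP.
by rewrite eqEcard sab !card_kset /=.
Qed.

Lemma row_free_incl i : (i <= n)%N -> row_free (W i).
Proof.
move=> lein; apply/row_freeP.
(* Multiplying by [W i] turns the disjointness matrix of levels [n, j] into the one of levels [i, j]
   times a nonzero binomial; dividing by that binomial leaves the sum in [sum_disj_incl]. *)
exists (\sum_(j < i.+1) (-1) ^+ j *: ('C(m - i - j, n - i)%:R^-1 *: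
  (disj_mx R m n j *m incl_mx R m j i))).
rewrite mulmx_sumr -sum_disj_incl; apply: eq_bigr => j _.
rewrite -!scalemxAr mulmxA mul_incl_disj // -scalemxAl [_^-1 *: _]scalerA.
rewrite mulVf ?scale1r //.
by rewrite pnatr_eq0 -lt0n bin_gt0; have := ltn_ord j; lia.
Qed.

Lemma incl_sub j i : (j <= i <= n)%N -> (W j <= W i)%MS.
Proof.
case/andP=> leji lein.
have c0 : 'C(n - j, i - j)%:R != 0 :> R.
  by rewrite pnatr_eq0 -lt0n bin_gt0 leq_sub2r.
rewrite -[W j](scalerK c0) -mul_incl_incl // scalemx_sub // submxMl //.
Qed.

(** The index is shifted: [level_proj i.+1] is the [F_i] of the overview and [level_proj 0] stands
    for [F_(-1)], so that [eigen_proj 0] is no special case. *)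
Definition level_proj i : 'M[R]_N := if i is j.+1 then oproj (W j) else 0.
Local Notation G := level_proj.

Definition eigen_proj i : 'M[R]_N := G i.+1 - G i.
Local Notation E := eigen_proj.

Lemma tr_level_proj i : (G i)^T = G i.
Proof. by case: i => [|i]; rewrite ?trmx0 //= tr_oproj. Qed.

Lemma incl_mul_level j i : (j < i <= n.+1)%N -> W j *m G i = W j.
Proof.
case: i => // i /andP[leji lein] /=.
by rewrite mul_oproj ?row_free_incl // incl_sub // -ltnS leji.
Qed.

Lemma level_projM i j : (i <= j <= n.+1)%N -> G i *m G j = G i.
Proof.
case: i => [|i] leij; first by rewrite mul0mx.
have /submxP[Y GE] : (G i.+1 <= W i)%MS by exact: oproj_sub.
by rewrite GE -mulmxA incl_mul_level.
Qed.

Lemma level_projMr i j : (i <= j <= n.+1)%N -> G j *m G i = G i.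
Proof.
move=> leij; apply: trmx_inj.
by rewrite trmx_mul !tr_level_proj level_projM.
Qed.

Lemma level_proj_full : G n.+1 = 1%:M.
Proof.
rewrite -[G _]mul1mx mul_oproj ?row_free_incl //.
by rewrite incl_mx_id submx_refl.
Qed.

Lemma tr_eigen_proj i : (E i)^T = E i.
Proof. by rewrite /E [LHS]raddfB /= tr_oproj tr_level_proj. Qed.

Lemma eigen_projM i j : (i <= n)%N -> (j <= n)%N ->
  E i *m E j = if i == j then E i else 0.
Proof.
move=> lein lejn; rewrite /E !mulmxBr !mulmxBl.
case: (ltngtP i j) => [ltij|ltji|<-].
- by rewrite !level_projM ?subrr //; lia.
- by rewrite !level_projMr ?subrr //; lia.
rewrite (level_projM (i := i.+1)) ?(level_projM (i := i)) ?level_projMr ?subrr ?subr0 //; lia.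
Qed.

Lemma sum_eigen_proj : \sum_(i < n.+1) E i = 1%:M.
Proof.
by rewrite -(big_mkord xpredT E) telescope_sumr // subr0 level_proj_full.
Qed.

Local Notation T := (disj_mx R m n n).

Lemma tr_disj : T^T = T.
Proof. by apply/matrixP => a b; rewrite !mxE disjoint_sym. Qed.

Lemma incl_mul_disj i : (i <= n)%N ->
  W i *m T = (n.+1 - i)%:R *: disj_mx R m i n.
Proof.
move=> lein; rewrite mul_incl_disj //; congr (_%:R *: _).
have -> : (m - i - n = (n - i).+1)%N by lia.
rewrite binSn; lia.
Qed.

(** In [disj_mx_incl] the term [j = i] is the signed [W i]; the other terms factor through some
    [W j] with [j < i], which [G i] fixes. *)
Lemma disj_leading_term i : (i <= n)%N ->
  exists2 Z, disj_mx R m i n = (-1) ^+ i *: W i + Z & Z *m G i = Z.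
Proof.
move=> lein; rewrite disj_mx_incl big_ord_recr /= incl_mx_id trmx1 mul1mx addrC.
eexists; first by [].
rewrite mulmx_suml; apply: eq_bigr => j _.
by rewrite -scalemxAl -mulmxA incl_mul_level // ltn_ord /= ltnW.
Qed.

Lemma incl_disj_sub i : (i <= n)%N -> (W i *m T <= W i)%MS.
Proof.
move=> lein; rewrite incl_mul_disj // scalemx_sub // disj_mx_incl.
apply: summx_sub => j _; apply: scalemx_sub.
apply: submx_trans (submxMl _ _) _; apply: incl_sub.
by rewrite lein -ltnS ltn_ord.
Qed.

Lemma level_proj_disj i : (i <= n.+1)%N -> G i *m T = T *m G i.
Proof.
case: i => [|i] lein; first by rewrite mul0mx mulmx0.
by rewrite /= oproj_comm ?tr_disj ?row_free_incl ?incl_disj_sub.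
Qed.

(* [Q := E i *m T - l *: E i] has its rows in the span of level [i - 1], yet is
   orthogonal to that span. *)
Lemma eigen_proj_disj i : (i <= n)%N ->
  E i *m T = ((-1) ^+ i * (n.+1 - i)%:R) *: E i.
Proof.
move=> lein; set l := _ * _; apply/eqP; rewrite -subr_eq0; apply/eqP.
set Q := _ - _.
have GGi : G i *m G i = G i by rewrite level_projM //; lia.
have EGi : E i *m G i = 0 by rewrite mulmxBl GGi level_projMr ?subrr //; lia.
have QGi : Q *m G i = 0.
  rewrite mulmxBl -scalemxAl EGi scaler0 subr0 -mulmxA -level_proj_disj //; last lia.
  by rewrite mulmxA EGi mul0mx.
(* As [Q *m G i = 0], it suffices that [G i] fixes [Q]. Below, the leading term of [G i.+1 *m T]
   cancels against [l *: G i.+1], leaving only lower-level terms. *)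
rewrite -QGi.
have /submxP[Y GE] : (G i.+1 <= W i)%MS by exact: oproj_sub.
have [Z ZE ZG] := disj_leading_term lein.
have -> : Q = (n.+1 - i)%:R *: (Y *m Z) - (G i *m T - l *: G i).
  rewrite /Q /E mulmxBl {1}GE -mulmxA incl_mul_disj // ZE.
  rewrite -scalemxAr mulmxDr -scalemxAr -GE scalerDr scalerA.
  rewrite scalerBr [_%:R * _]mulrC -/l.
  have cancel (a b c d : 'M[R]_N) : a + b - c - (a - d) = b - (c - d).
    by apply/matrixP => x y; rewrite !mxE; ring.
  exact: cancel.
rewrite mulmxBl -scalemxAl -mulmxA ZG mulmxBl -scalemxAl GGi.
by rewrite -mulmxA -level_proj_disj ?mulmxA ?GGi //; lia.
Qed.

Definition sign_mx : 'M[R]_N := \sum_(i < n.+1) (-1) ^+ i *: E i.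
Definition abs_mx : 'M[R]_N := \sum_(i < n.+1) (n.+1 - i)%:R *: E i.

Lemma tr_sign_mx : sign_mx^T = sign_mx.
Proof.
rewrite /sign_mx raddf_sum; apply: eq_bigr => i _.
by rewrite /= linearZ /= tr_eigen_proj.
Qed.

Lemma sign_mxK : sign_mx *m sign_mx = 1%:M.
Proof.
rewrite /sign_mx -sum_eigen_proj mulmx_suml; apply: eq_bigr => i _.
rewrite mulmx_sumr (bigD1 i) //= big1 ?addr0 => [|j neji].
  rewrite -scalemxAl -scalemxAr eigen_projM ?leq_ord // eqxx scalerA -expr2.
  by rewrite sqrr_sign scale1r.
rewrite -scalemxAl -scalemxAr eigen_projM ?leq_ord // ifN ?scaler0 //.
by rewrite eq_sym.
Qed.

Lemma sign_mx_disj : sign_mx *m T = abs_mx.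
Proof.
rewrite mulmx_suml; apply: eq_bigr => i _.
rewrite -scalemxAl eigen_proj_disj ?leq_ord // scalerA mulrA -expr2 sqrr_sign.
by rewrite mul1r.
Qed.

Lemma disj_spectral :
  T = \sum_(i < n.+1) ((-1) ^+ i * (n.+1 - i)%:R) *: E i.
Proof.
rewrite -[LHS]mul1mx -sum_eigen_proj mulmx_suml; apply: eq_bigr => i _.
by rewrite eigen_proj_disj ?leq_ord.
Qed.

(** Abel summation: [E i] is a summand of [G j.+1] for exactly the [n.+1 - i] indices [j] from [i]
    to [n]. The induction varies the number of levels. *)
Lemma abs_mx_level : abs_mx = \sum_(i < n.+1) G i.+1.
Proof.
rewrite /abs_mx.
have sumE k : \sum_(i < k) (k - i)%:R *: E i = \sum_(i < k) G i.+1.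
  elim: k => [|k IHk]; first by rewrite !big_ord0.
  have GE : G k.+1 = \sum_(i < k.+1) E i.
    by rewrite -(big_mkord xpredT E) telescope_sumr // subr0.
  rewrite [RHS]big_ord_recr /= -/(G k.+1) GE -IHk.
  rewrite (_ : \sum_(i < k) _ = \sum_(i < k.+1) (k - i)%:R *: E i); last first.
    by rewrite big_ord_recr /= subnn scale0r addr0.
  rewrite -big_split; apply: eq_bigr => i _ /=.
  by rewrite subSn ?leq_ord // -natr1 scalerDl scale1r.
exact: sumE.
Qed.

(** Since [m] is odd, the symmetry of the binomials splits row [m] of Pascal's triangle into two
    halves of equal sum. *)
Lemma sum_bin_half : (\sum_(i < n.+1) 'C(m, i) = 2 ^ n.*2)%N.
Proof.
apply/eqP; rewrite -(eqn_pmul2l (isT : 0 < 2)%N) -expnS; apply/eqP.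
have -> : (2 ^ m = \sum_(i < m.+1) 'C(m, i))%N.
  rewrite -[2%N]/(1 + 1)%N expnDn; apply: eq_bigr => i _.
  by rewrite !exp1n !muln1.
have -> : m.+1 = (n.+1 + n.+1)%N by lia.
rewrite big_split_ord /= mul2n -addnn; congr addn.
rewrite (reindex_inj rev_ord_inj) /=; apply: eq_bigr => i _.
rewrite -bin_sub; last by have := ltn_ord i; lia.
by congr 'C(_, _); have := ltn_ord i; lia.
Qed.

Lemma mxtrace_abs_mx : \tr abs_mx = 2 ^+ n.*2.
Proof.
rewrite abs_mx_level raddf_sum /= -natrX -sum_bin_half natr_sum.
apply: eq_bigr => i _.
by rewrite mxtrace_oproj ?card_ksub // row_free_incl ?leq_ord.
Qed.

Lemma level_proj_kperm i s : (i <= n.+1)%N ->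
  G i *m kperm_mx R n s = kperm_mx R n s *m G i.
Proof.
case: i => [|i] lein; first by rewrite mul0mx mulmx0.
by rewrite /= oproj_comm ?tr_kperm_mx ?row_free_incl // incl_kperm submxMl.
Qed.

Lemma eigen_proj_act i s a b : (i <= n)%N -> E i (kact s a) (kact s b) = E i a b.
Proof.
move=> lein; rewrite -mulmx_kperm mulmxBl !level_proj_kperm -?mulmxBr; try lia.
by rewrite mul_kperm_mx kactK.
Qed.

Lemma sign_mx_act s a b : sign_mx (kact s a) (kact s b) = sign_mx a b.
Proof.
rewrite !summxE; apply: eq_bigr => i _.
by rewrite mxE [RHS]mxE eigen_proj_act ?leq_ord.
Qed.

Lemma abs_mx_diag a : abs_mx a a = 2 ^+ n.*2 / 'C(m, n)%:R.
Proof.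
have c0 : 'C(m, n)%:R != 0 :> R by rewrite pnatr_eq0 -lt0n bin_gt0; lia.
apply: (mulIf c0); rewrite divfK // -mxtrace_abs_mx /mxtrace.
rewrite (eq_bigr (fun=> abs_mx a a)) => [|b _].
  by rewrite sumr_const card_ord -(card_ksub m n) mulr_natr.
have [s <-] := kact_transitive a b.
rewrite !summxE; apply: eq_bigr => i _.
by rewrite mxE [RHS]mxE eigen_proj_act ?leq_ord.
Qed.

End OddGraphSpectrum.

(** * The spectral identities read on entries indexed by subsets *)

Section EntrywiseSpectrum.
Variables (R : realFieldType) (n : nat).
Local Notation v := (2 ^+ n.*2 / 'C(n.*2.+1, n)%:R : R).

Definition eigen_entry i (A B : nsub n) : R :=
  eigen_proj R n i (enum_rank A) (enum_rank B).
Definition sign_entry (A B : nsub n) : R :=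
  sign_mx R n (enum_rank A) (enum_rank B).

Lemma sum_enum_rank (V : nmodType) (F : 'I_#|nsub n| -> V) :
  \sum_a F a = \sum_(A : nsub n) F (enum_rank A).
Proof. exact/reindex/onW_bij/enum_rank_bij. Qed.

Lemma kset_rank (A : nsub n) : @kset n.*2.+1 n (enum_rank A) = val A.
Proof. by rewrite /kset enum_rankK. Qed.

Lemma eigen_entry_sqr i A B : (i <= n)%N ->
  \sum_D eigen_entry i A D * eigen_entry i B D =
  eigen_proj R n i (enum_rank A) (enum_rank B).
Proof.
move=> lein; have := eigen_projM R lein lein; rewrite eqxx => EE.
rewrite -[in RHS]EE mxE sum_enum_rank; apply: eq_bigr => D _; congr (_ * _).
by rewrite -[in RHS]tr_eigen_proj [RHS]mxE.
Qed.

(** The modulus of each eigenvalue stays a nonnegative weight and its sign goes to the left factor.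
    Both factors then have weighted square sum [v], and no square roots are needed. *)
Lemma disjoint_factor (A B : nsub n) : [disjoint val A & val B]%:R =
  \sum_(k : 'I_n.+1 * nsub n) (n.+1 - k.1)%:R *
    ((-1) ^+ k.1 * eigen_entry k.1 A k.2) * eigen_entry k.1 B k.2.
Proof.
transitivity (disj_mx R n.*2.+1 n n (enum_rank A) (enum_rank B)).
  by rewrite mxE !kset_rank.
rewrite disj_spectral summxE.
rewrite -(pair_bigA _ (fun (i : 'I_n.+1) D => (n.+1 - i)%:R *
  ((-1) ^+ i * eigen_entry i A D) * eigen_entry i B D)) /=.
apply: eq_bigr => i _; rewrite mxE -eigen_entry_sqr ?leq_ord // mulr_sumr.
by apply: eq_bigr => D _; ring.
Qed.

Lemma eigen_weight (A : nsub n) :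
  \sum_(k : 'I_n.+1 * nsub n) (n.+1 - k.1)%:R * eigen_entry k.1 A k.2 ^+ 2 = v.
Proof.
rewrite -(abs_mx_diag R (enum_rank A)) summxE.
rewrite -(pair_bigA _ (fun (i : 'I_n.+1) D => (n.+1 - i)%:R *
  eigen_entry i A D ^+ 2)) /=.
apply: eq_bigr => i _; rewrite mxE -eigen_entry_sqr ?leq_ord // mulr_sumr.
by apply: eq_bigr => D _; rewrite expr2.
Qed.

Lemma sign_entryC A B : sign_entry A B = sign_entry B A.
Proof. by rewrite /sign_entry -[in LHS]tr_sign_mx mxE. Qed.

Lemma sign_entry_orthogonal A B :
  \sum_D sign_entry D A * sign_entry D B = (A == B)%:R.
Proof.
have /matrixP/(_ (enum_rank A) (enum_rank B)) := sign_mxK R n.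
rewrite !mxE (inj_eq enum_rank_inj) => <-; rewrite sum_enum_rank.
by apply: eq_bigr => D _; rewrite sign_entryC.
Qed.

Lemma sign_entry_perm (s : {perm 'I_n.*2.+1}) (A B A' B' : nsub n) :
  val A' = s @: val A -> val B' = s @: val B ->
  sign_entry A' B' = sign_entry A B.
Proof.
have rank_act (X X' : nsub n) : val X' = s @: val X ->
    enum_rank X' = @kact n.*2.+1 n s (enum_rank X).
  by move=> XE; apply: kset_inj; rewrite kset_act !kset_rank.
by move=> /rank_act AE /rank_act BE; rewrite /sign_entry AE BE sign_mx_act.
Qed.

(** By symmetry of disjointness this row sum is a diagonal entry of [sign_mx *m T], that is, of
    [abs_mx]. *)
Lemma sum_disjoint_sign (A : nsub n) :
  \sum_(B : nsub n) [disjoint val A & val B]%:R * sign_entry A B = v.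
Proof.
rewrite -(abs_mx_diag R (enum_rank A)) -sign_mx_disj mxE sum_enum_rank.
apply: eq_bigr => B _; rewrite mxE !kset_rank disjoint_sym mulrC.
by [].
Qed.

End EntrywiseSpectrum.

(** * Operator norms and bounds for Schur multipliers *)

Section OperatorNorm.
Variables (R : realType) (n : nat).
Local Notation C := R[i].
Local Notation I := (nsub n).
Local Notation ReC := complex.Re.
Local Notation ImC := complex.Im.
Local Open Scope complex_scope.
Implicit Types (M T : mat R n) (x : vect R n).

Lemma Re_sum (K : finType) (F : K -> C) : ReC (\sum_k F k) = \sum_k ReC (F k).
Proof. by apply: (@big_morph _ _ (@complex.Re R) 0 +%R 0 +%R) => // -[a b] [c d]. Qed.

Lemma Im_sum (K : finType) (F : K -> C) : ImC (\sum_k F k) = \sum_k ImC (F k).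
Proof. by apply: (@big_morph _ _ (@complex.Im R) 0 +%R 0 +%R) => // -[a b] [c d]. Qed.

Lemma Re_scale (r : R) (z : C) : ReC (r%:C * z) = r * ReC z.
Proof. by case: z => a b; rewrite /= mul0r subr0. Qed.

Lemma Im_scale (r : R) (z : C) : ImC (r%:C * z) = r * ImC z.
Proof. by case: z => a b; rewrite /= mul0r addr0. Qed.

Lemma cabs2_ge0 (z : C) : 0 <= cabs2 z.
Proof. by rewrite addr_ge0 ?sqr_ge0. Qed.

Lemma cabs2M (y z : C) : cabs2 (y * z) = cabs2 y * cabs2 z.
Proof. by case: y z => a b [c d]; rewrite /cabs2 /=; ring. Qed.

Lemma cabs2_real (r : R) : cabs2 r%:C = r ^+ 2.
Proof. by rewrite /cabs2 /=; ring. Qed.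

Lemma cabs2_eq0 (z : C) : cabs2 z = 0 -> z = 0.
Proof.
case: z => a b /eqP; rewrite /cabs2 paddr_eq0 ?sqr_ge0 // !sqrf_eq0 /=.
by case/andP=> /eqP-> /eqP->.
Qed.

Lemma weighted_CauchySchwarz (K : finType) (w c y : K -> R) :
  (forall k, 0 <= w k) ->
  (\sum_k w k * c k * y k) ^+ 2 <=
  (\sum_k w k * c k ^+ 2) * (\sum_k w k * y k ^+ 2).
Proof.
move=> w0; rewrite -subr_ge0 expr2 !big_distrlr /= -sumrB.
under eq_bigr do rewrite -sumrB.
(* Lagrange's identity: adding [S] to itself with the indices exchanged makes every term a weighted
   square. *)
set S := \sum_k _; suff : 0 <= S + S by lra.
rewrite {2}/S exchange_big -big_split sumr_ge0 // => k _.
rewrite -big_split sumr_ge0 // => l _ /=.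
rewrite (_ : _ + _ = w k * w l * (c k * y l - c l * y k) ^+ 2); last by ring.
by rewrite mulr_ge0 ?sqr_ge0 ?mulr_ge0.
Qed.

(** The coefficients are real, so the real inequality applies to real and imaginary parts
    separately. *)
Lemma cabs2_CauchySchwarz (K : finType) (w c : K -> R) (z : K -> C) :
  (forall k, 0 <= w k) ->
  cabs2 (\sum_k (w k * c k)%:C * z k) <=
  (\sum_k w k * c k ^+ 2) * (\sum_k w k * cabs2 (z k)).
Proof.
move=> w0; rewrite /cabs2 Re_sum Im_sum.
under eq_bigr do rewrite Re_scale.
under [X in _ + X ^+ 2]eq_bigr do rewrite Im_scale.
under [X in _ <= _ * X]eq_bigr do rewrite mulrDr.
by rewrite big_split mulrDr lerD // weighted_CauchySchwarz.
Qed.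

Lemma vnorm_ge0 x : 0 <= vnorm x.
Proof. exact: sqrtr_ge0. Qed.

Lemma sqr_vnorm x : vnorm x ^+ 2 = \sum_A cabs2 (x A).
Proof. by rewrite sqr_sqrtr // sumr_ge0 // => A _; exact: cabs2_ge0. Qed.

Lemma vnormZ (r : R) x : 0 <= r -> vnorm (fun A => r%:C * x A) = r * vnorm x.
Proof.
move=> r0; apply/eqP; rewrite -(eqrXn2 (ltn0Sn 1)) ?mulr_ge0 ?vnorm_ge0 //.
rewrite exprMn !sqr_vnorm mulr_sumr; apply/eqP.
by apply: eq_bigr => A _; rewrite cabs2M cabs2_real.
Qed.

Lemma vnorm_eq0 x : vnorm x = 0 -> x = fun=> 0.
Proof.
move=> nx0; have := sqr_vnorm x; rewrite nx0 expr0n /= => /esym/eqP.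
rewrite psumr_eq0; last by move=> A _; exact: cabs2_ge0.
move=> /allP x0; apply: funext => A; apply: cabs2_eq0.
by have := x0 A; rewrite mem_index_enum => /(_ isT) /eqP.
Qed.

Lemma mapplyZ M (c : C) x :
  mapply M (fun A => c * x A) = fun A => c * mapply M x A.
Proof.
apply: funext => A; rewrite /mapply mulr_sumr.
by apply: eq_bigr => B _; rewrite mulrCA.
Qed.

Lemma vnorm0 : vnorm ((fun=> 0) : vect R n) = 0.
Proof.
rewrite /vnorm big1 ?sqrtr0 // => A _.
by rewrite /cabs2 /= expr0n addr0.
Qed.

(** A crude Frobenius bound, enough to make the supremum in [opnorm] an actual upper bound rather
    than a default value. *)
Lemma mapply_bounded M : has_ubound
  [set r : R | exists x : vect R n, vnorm x <= 1 /\ r = vnorm (mapply M x)]%classic.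
Proof.
pose D := \sum_A \sum_B cabs2 (M A B).
exists (Num.sqrt (#|I|%:R * D)) => _ [x [nx ->]].
rewrite ler_sqrt; last first.
  rewrite mulr_ge0 // sumr_ge0 // => A _; rewrite sumr_ge0 // => B _.
  exact: cabs2_ge0.
rewrite mulr_sumr ler_sum // => A _.
have -> : mapply M x A = \sum_B (1 * 1)%:C * (M A B * x B).
  by apply: eq_bigr => B _; rewrite mulr1 mul1r.
apply: le_trans (cabs2_CauchySchwarz _ _ _) _ => //.
rewrite expr1n mulr1 sumr_const cardT -cardE ler_wpM2l //.
apply: ler_sum => B _; rewrite mul1r cabs2M ler_piMr ?cabs2_ge0 //.
have : vnorm x ^+ 2 <= 1 by rewrite exprn_ile1 // vnorm_ge0.
rewrite sqr_vnorm; apply: le_trans; rewrite (bigD1 B) //= lerDl sumr_ge0 //.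
by move=> E _; exact: cabs2_ge0.
Qed.

Lemma vnorm_mapply_le M x : vnorm (mapply M x) <= opnorm M * vnorm x.
Proof.
have [nx0|nx0] := eqVneq (vnorm x) 0.
  rewrite nx0 mulr0 (vnorm_eq0 nx0) (_ : mapply M _ = fun=> 0) ?vnorm0 //.
  by apply: funext => A; rewrite /mapply big1 // => B _; rewrite mulr0.
have nx : 0 < vnorm x by rewrite lt_neqAle eq_sym nx0 vnorm_ge0.
rewrite -ler_pdivrMr // mulrC -vnormZ ?invr_ge0 ?vnorm_ge0 // -mapplyZ.
apply: ub_le_sup; first exact: mapply_bounded.
eexists; split; last reflexivity.
by rewrite vnormZ ?invr_ge0 ?vnorm_ge0 // mulVf.
Qed.

Lemma opnorm_le M (c : R) : 0 <= c ->
  (forall x, \sum_A cabs2 (mapply M x A) <= c ^+ 2 * \sum_A cabs2 (x A)) ->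
  opnorm M <= c.
Proof.
move=> c0 Mc; apply: ge_sup.
  exists (vnorm (mapply M (fun=> 0))), (fun=> 0); split => //.
  by rewrite vnorm0.
move=> _ [x [nx ->]]; rewrite -(ler_pXn2r (ltn0Sn 1)) ?nnegrE ?vnorm_ge0 //.
rewrite sqr_vnorm (le_trans (Mc x)) // -sqr_vnorm ler_piMr ?sqr_ge0 //.
by rewrite exprn_ile1 ?vnorm_ge0.
Qed.

Lemma contractionP M x : opnorm M <= 1 ->
  \sum_A cabs2 (mapply M x A) <= \sum_A cabs2 (x A).
Proof.
move=> M1; rewrite -!sqr_vnorm ler_pXn2r ?nnegrE ?vnorm_ge0 //.
apply: le_trans (vnorm_mapply_le _ _) _.
by rewrite ler_piMl ?vnorm_ge0.
Qed.

(* The easy half of Grothendieck's factorization criterion for Schur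
   multipliers. *)
Lemma schur_factor_le (K : finType) (w : K -> R) (a b : K -> I -> R) T (c : R) M :
  0 <= c -> (forall k, 0 <= w k) ->
  (forall A B, T A B = (\sum_k w k * a k A * b k B)%:C) ->
  (forall A, \sum_k w k * a k A ^+ 2 = c) ->
  (forall B, \sum_k w k * b k B ^+ 2 = c) ->
  opnorm M <= 1 -> opnorm (schur T M) <= c.
Proof.
move=> c0 w0 TE ac bc M1; apply: opnorm_le => // x.
(* The factorization writes the Schur product at [x] as a weighted combination of the vectors
   [M (y k)]. Cauchy-Schwarz over [k] yields one factor [c] from [a]; contractivity of [M] on each
   [y k], then summing over [k], yields the other from [b]. *)
pose y k : vect R n := fun B => (b k B)%:C * x B.
have SE A : mapply (schur T M) x A = \sum_k (w k * a k A)%:C * mapply M (y k) A.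
  rewrite /mapply /schur; under [RHS]eq_bigr do rewrite mulr_sumr.
  rewrite exchange_big; apply: eq_bigr => B _ /=.
  rewrite TE rmorph_sum !mulr_suml; apply: eq_bigr => k _.
  by rewrite /y rmorphM /=; ring.
apply: (@le_trans _ _ (\sum_A c * \sum_k w k * cabs2 (mapply M (y k) A))).
  apply: ler_sum => A _; rewrite SE.
  by apply: le_trans (cabs2_CauchySchwarz _ _ w0) _; rewrite ac.
rewrite -mulr_sumr expr2 -mulrA ler_wpM2l // exchange_big /=.
apply: (@le_trans _ _ (\sum_k w k * \sum_B cabs2 (y k B))).
  by apply: ler_sum => k _; rewrite -mulr_sumr ler_wpM2l ?contractionP.
under [X in X <= _]eq_bigr do rewrite mulr_sumr.
rewrite exchange_big mulr_sumr /= le_eqVlt; apply/orP; left; apply/eqP.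
apply: eq_bigr => B _; rewrite -(bc B) mulr_suml; apply: eq_bigr => k _.
by rewrite cabs2M cabs2_real mulrA.
Qed.

Lemma sum_sqr_orthogonal (u : I -> I -> R) (r : I -> R) :
  (forall A B, \sum_D u D A * u D B = (A == B)%:R) ->
  \sum_D (\sum_A u D A * r A) ^+ 2 = \sum_A r A ^+ 2.
Proof.
move=> uu; transitivity (\sum_A \sum_B r A * r B * \sum_D u D A * u D B).
  under eq_bigr do rewrite expr2 big_distrlr /=.
  rewrite exchange_big; apply: eq_bigr => A _ /=; rewrite exchange_big.
  by apply: eq_bigr => B _ /=; rewrite mulr_sumr; apply: eq_bigr => D _; ring.
apply: eq_bigr => A _; rewrite (bigD1 A) //= uu eqxx mulr1 big1 ?addr0 ?expr2 //.
by move=> B /negPf nBA; rewrite uu eq_sym nBA mulr0.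
Qed.

(** A real orthogonal matrix preserves the square sums of the real and imaginary parts
    separately. *)
Lemma opnorm_orthogonal (u : I -> I -> R) :
  (forall A B, \sum_D u D A * u D B = (A == B)%:R) ->
  opnorm (fun A B => (u A B)%:C) <= 1.
Proof.
move=> uu; apply: opnorm_le => // x; rewrite expr1n mul1r /cabs2 !big_split /=.
rewrite -(sum_sqr_orthogonal (fun A => ReC (x A)) uu).
rewrite -(sum_sqr_orthogonal (fun A => ImC (x A)) uu).
rewrite /mapply lerD //; apply: ler_sum => A _; rewrite ?Re_sum ?Im_sum.
  by under eq_bigr do rewrite Re_scale.
by under eq_bigr do rewrite Im_scale.
Qed.

End OperatorNorm.

(** * The product formula and its logarithmic lower bound *)

Section CentralBinomialRatio.
Variable R : realType.

(** After multiplication by [n.+1], two absorption identities link both sides through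
    ['C(n.*2.+2, n)]. *)
Lemma bin_odd_central_rec n :
  ('C(n.+1.*2.+1, n.+1) * n.+2 = 2 * (2 * n + 3) * 'C(n.*2.+1, n))%N.
Proof.
have e1 := mul_bin_diag n.*2.+3 n; have e2 := mul_bin_down n.*2.+2 n.
rewrite /= in e1 e2.
apply/eqP; rewrite -(eqn_pmul2l (ltn0Sn n)) mulnA doubleS -e1; apply/eqP.
have -> : (n.+2 = n.*2.+2 - n)%N by lia.
rewrite -mulnA [('C(_, _) * (_ - _))%N]mulnC -e2; lia.
Qed.

(** By [bin_odd_central_rec], consecutive ratios differ by the factor
    [4 (n+2) / (2 (2n+3)) = 1 + 1/(2n+3)]. *)
Lemma bin_odd_central_ratio n :
  2 ^+ n.*2 / 'C(n.*2.+1, n)%:R =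
  \prod_(i < n) (1 + 1 / (2 * i.+1 + 1)%N%:R) :> R.
Proof.
elim: n => [|n IHn]; first by rewrite big_ord0 bin0 expr0 divr1.
have neq0 k : (0 < k)%N -> k%:R != 0 :> R by rewrite pnatr_eq0 lt0n.
rewrite big_ord_recr /= -IHn doubleS !exprS.
have /(congr1 (fun k => k%:R : R)) := bin_odd_central_rec n.
rewrite doubleS !natrM; set b := 'C(n.*2.+1, n)%:R; set b' := _%:R => e.
have b0 : b != 0 by rewrite neq0 // bin_gt0; lia.
have b'0 : b' != 0 by rewrite neq0 // bin_gt0; lia.
have -> : (2 * n.+1 + 1 = 2 * n + 3)%N by lia.
have q0 : (2 * n + 3)%:R != 0 :> R by rewrite neq0 //; lia.
have n0 : n.+2%:R != 0 :> R by rewrite neq0.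
have -> : b' = 2 * (2 * n + 3)%:R * b / n.+2%:R by rewrite -e mulfK.
have eq : 1 + (2 * n + 3)%:R = 2 * n.+2%:R :> R.
  by rewrite -natrM -[1]/(1%:R) -natrD; congr (_%:R); lia.
move: (2 * n + 3)%:R n.+2%:R (2 ^+ n.*2) q0 n0 eq => q d t q0 d0 eq.
transitivity (t / b * ((1 + q) / q)); first by rewrite eq; field; rewrite b0 q0 d0.
by field; rewrite b0 q0.
Qed.

Lemma prod_odd_ratio_ge1 n : 1 <= \prod_(i < n) (1 + 1 / (2 * i.+1 + 1)%N%:R) :> R.
Proof.
elim: n => [|n IHn]; first by rewrite big_ord0.
rewrite big_ord_recr /= mulr_ege1 // lerDl divr_ge0 //.
Qed.

(** With [q = 2n+3], the left side grows by half of [ln (1 + 2/q)], at most [1/q], while the product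
    [p >= 1] grows by [p/q]. *)
Lemma prod_odd_ratio_gt_half_ln n :
  2^-1 * ln (2 * n + 3)%N%:R < \prod_(i < n) (1 + 1 / (2 * i.+1 + 1)%N%:R) :> R.
Proof.
elim: n => [|n IHn].
  rewrite big_ord0 muln0 add0n -[X in _ < X](expRK 1).
  (* This is [1 + 2 < expR 2]. *)
  have : ln 3 < 2 :> R.
    rewrite -[X in _ < X]expRK ltr_ln ?posrE ?expR_gt0 //.
    by have := @expR_gt1Dx R 2; rewrite pnatr_eq0 => /(_ isT); lra.
  by rewrite expRK; lra.
rewrite big_ord_recr /=; set p := \prod_(_ < _) _ in IHn *.
have p1 : 1 <= p by exact: prod_odd_ratio_ge1.
set q : R := (2 * n + 3)%N%:R in IHn.
have q0 : 0 < q by rewrite ltr0n; lia.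
have -> : (2 * n.+1 + 1)%N%:R = q :> R by congr (_%:R); lia.
have -> : (2 * n.+1 + 3)%N%:R = q * (1 + 2 / q) :> R.
  rewrite mulrDr mulr1 mulrCA divff ?gt_eqF // mulr1 /q -natrD; congr (_%:R); lia.
rewrite lnM ?posrE // ?addr_gt0 ?divr_gt0 //.
have : ln (1 + 2 / q) <= 2 / q.
  by apply: le_ln1Dx; apply: (@lt_trans _ _ 0); rewrite ?divr_gt0 // ltrN10.
have : 1 / q <= p / q by rewrite ler_pM2r ?invr_gt0.
lra.
Qed.

End CentralBinomialRatio.

(** * The Schur multiplier norm of the Kneser matrix *)

Section KneserMultiplier.
Variables (R : realType) (n : nat).
Local Open Scope complex_scope.
Local Notation v := (2 ^+ n.*2 / 'C(n.*2.+1, n)%:R : R).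

Definition kneser_sign : mat R n := fun A B => (sign_entry R A B)%:C.

Lemma kneserE (A B : nsub n) : @kneser R n A B = [disjoint val A & val B]%:R%:C.
Proof. by rewrite /kneser; case: ifP. Qed.

Lemma kneser_ratio_ge0 : 0 <= v.
Proof. by rewrite divr_ge0 ?exprn_ge0. Qed.

Lemma opnorm_schur_kneser_le M : opnorm M <= 1 -> opnorm (schur (@kneser R n) M) <= v.
Proof.
apply: (@schur_factor_le _ _ ('I_n.+1 * nsub n)%type (fun k => (n.+1 - k.1)%:R)
  (fun k A => (-1) ^+ k.1 * eigen_entry R k.1 A k.2)
  (fun k B => eigen_entry R k.1 B k.2)) => //.
- exact: kneser_ratio_ge0.
- by move=> A B; rewrite kneserE disjoint_factor.
- move=> A; rewrite -(eigen_weight R A); apply: eq_bigr => k _.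
  by rewrite exprMn sqrr_sign mul1r.
- exact: eigen_weight.
Qed.

Lemma opnorm_kneser_sign : opnorm kneser_sign <= 1.
Proof. exact/opnorm_orthogonal/sign_entry_orthogonal. Qed.

Lemma nsub_act_subproof (s : {perm 'I_n.*2.+1}) (A : nsub n) : #|s @: val A| == n.
Proof. by rewrite card_imset ?(eqP (valP A)) //; exact: perm_inj. Qed.

Definition nsub_act (s : {perm 'I_n.*2.+1}) (A : nsub n) : nsub n :=
  Sub (s @: val A) (nsub_act_subproof s A).

(** Each product collapses to one term: the entry at [(A, s B)] on one side and at [(s^-1 A, B)] on
    the other, equal by invariance under [s]. *)
Lemma kneser_sign_commutant : in_commutant kneser_sign.
Proof.
move=> s; apply: funext => A; apply: funext => B; rewrite /mmul /perm_op.
rewrite (bigD1 (nsub_act s B)) //= eqxx mulr1 big1 ?addr0; last first.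
  move=> D; rewrite -val_eqE => /negPf /= ->; exact: mulr0.
have AE : val A = s @: val (nsub_act s^-1%g A).
  by apply/eqP; rewrite eq_imset_perm.
rewrite (bigD1 (nsub_act s^-1%g A)) //= -AE eqxx mul1r big1 ?addr0; last first.
  by move=> D; rewrite -val_eqE eq_sym eq_imset_perm => /negPf /= ->; rewrite mul0r.
congr (_%:C); exact: (@sign_entry_perm _ _ s).
Qed.

Lemma opnorm_schur_kneser_sign : v <= opnorm (schur (@kneser R n) kneser_sign).
Proof.
pose one : vect R n := fun=> 1.
have one_gt0 : 0 < vnorm one.
  rewrite sqrtr_gt0 (eq_bigr (fun=> 1)) => [|A _]; last first.
    by rewrite /cabs2 /= expr1n expr0n addr0.
  by rewrite sumr_const ltr0n card_ksub bin_gt0; lia.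
have SE : mapply (schur (@kneser R n) kneser_sign) one = fun A => v%:C * one A.
  apply: funext => A; rewrite mulr1 -(sum_disjoint_sign R A) rmorph_sum.
  by apply: eq_bigr => B _; rewrite mulr1 /schur kneserE rmorphM.
have := vnorm_mapply_le (schur (@kneser R n) kneser_sign) one.
by rewrite SE vnormZ ?kneser_ratio_ge0 // ler_pM2r.
Qed.

(** Treats both norms at once: in any class of contractions containing the sign matrix, that matrix
    attains the upper bound [v]. *)
Lemma sup_schur_kneser (S : set (mat R n)) :
  (forall M, S M -> opnorm M <= 1) -> S kneser_sign ->
  sup [set r | exists M, S M /\ r = opnorm (schur (@kneser R n) M)]%classic = v.
Proof.
move=> S1 SU; set X := (X in sup X).
have Xub : ubound X v.
  by move=> _ [M [SM ->]]; exact/opnorm_schur_kneser_le/S1.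
have XU : X (opnorm (schur (@kneser R n) kneser_sign)) by exists kneser_sign.
apply/eqP; rewrite eq_le ge_sup /=; [|by eexists; exact: XU|exact: Xub].
apply: le_trans opnorm_schur_kneser_sign _.
by apply: ub_le_sup XU; exists v.
Qed.

End KneserMultiplier.

Theorem theorem5p5 (R : realType) (n : nat) (hn : (1 <= n)%N) :
  let v : R := 2 ^+ (n.*2) / ('C(n.*2.+1, n))%:R in
  [/\ @schur_norm R n (@kneser R n) = v,
      @schur_norm_commutant R n (@kneser R n) = v,
      v = (\prod_(i < n) ((2 * i.+1 + 2)%N%:R : R)) /
          (\prod_(i < n) ((2 * i.+1 + 1)%N%:R : R)),
      v = \prod_(i < n) (1 + 1 / (2 * i.+1 + 1)%N%:R)
    & v > 2^-1 * ln ((2 * n + 3)%N%:R)].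
Proof.
move=> v; split.
- apply: (sup_schur_kneser (S := fun M => opnorm M <= 1)) => //.
  exact: opnorm_kneser_sign.
- rewrite /v -(sup_schur_kneser (S := fun M => in_commutant M /\ opnorm M <= 1)).
  + congr (sup _); apply: funext => r; apply: propext.
    by split=> [[M [? [? ->]]]|[M [[? ?] ->]]]; exists M.
  + by move=> M [].
  + by split; [exact: kneser_sign_commutant|exact: opnorm_kneser_sign].
- rewrite /v bin_odd_central_ratio -prodf_div; apply: eq_bigr => i _.
  have -> : (2 * i.+1 + 2)%:R = (2 * i.+1 + 1)%:R + 1 :> R by rewrite natr1 addnS.
  by rewrite mulrDl divff // pnatr_eq0 addn1.
- exact: bin_odd_central_ratio.
- by rewrite /v bin_odd_central_ratio prod_odd_ratio_gt_half_ln.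
Qed.
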